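(* Let $(X,d)$ be a complete metric space and let $\mathcal S=(X,(f_i)_{i\in I})$ be an iterated function system of bi-Lipschitz contractions on $X$ ($I$ finite or infinite) with attractor $A$ such that: (a) the coding map $\pi:I^\omega\to A$ is continuous and bijective; (b) with $c_{ij}:=\inf_{x,y\in A}d(f_i(x),f_j(y))$ for $i\ne j$ in $I$, one has $\inf_{i,j\in I,\,i\neq j}c_{ij}>0$. Then $\pi:I^\omega\to A$ is a homeomorphism.
   Context: $X$ and $I$ are nonempty. For a map $f$ between metric spaces, $\mathrm{lip}(f)=\sup_{x\neq y}d(f(x),f(y))/d(x,y)$. The system $\mathcal S$ is a family of contractions in the following sense: $\bigcup_{i\in I}f_i(B)$ is bounded for every bounded $B\subseteq X$ and $\sup_{i\in I}\mathrm{lip}(f_i)<1$. A map $f:X\to X$ is bi-Lipschitz if there are constants $0<l\le L<\infty$ with $l\,d(x,y)\le d(f(x),f(y))\le L\,d(x,y)$ for all $x,y\in X$. The attractor $A$ is the unique nonempty closed bounded set $A\subseteq X$ with $\overline{\bigcup_{i\in I}f_i(A)}=A$. The space $I^\omega=I^{\mathbb N}$ ($\mathbb N=\{1,2,\dots\}$) of infinite words over $I$ carries the metric $d_I(\alpha,\beta)=\sum_{n\ge1}\frac{1-\delta_{\alpha_n}^{\beta_n}}{3^n}$ ($\delta_x^y$ the Kronecker delta). The coding map (canonical projection) sends $\omega\in I^\omega$ to the unique point $\pi(\omega)=a_\omega$ of $\bigcap_{m\ge1}f_{\omega_1}\circ\cdots\circ f_{\omega_m}(A)$; equivalently $a_\omega=\lim_{m\to\infty}f_{\omega_1}\circ\cdots\circ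 f_{\omega_m}(a)$ for any $a\in A$. *)

(* Defs.v *)
From HB Require Import structures.
From mathcomp Require Import all_boot all_order all_algebra.
From mathcomp Require Import all_classical all_reals all_analysis.

Set Implicit Arguments.
Unset Strict Implicit.
Unset Printing Implicit Defensive.

Import Order.TTheory GRing.Theory Num.Theory.
Import numFieldNormedType.Exports.

Local Open Scope classical_set_scope.
Local Open Scope ring_scope.

(* [Complete] includes [isPointed]: these are the nonempty complete metric
   spaces. *)
#[short(type="completeMetricType")]
HB.structure Definition CompleteMetric (R : numDomainType) :=
  {T of CompletePseudoMetric R T & Metric R T}.

Definition homeomorphism (T U : topologicalType) (h : T -> U) : Prop :=
  continuous h /\
  exists g : U -> T, [/\ cancel h g, cancel g h & continuous g].

Section metric.
Context {R : realType} {X : metricType R}.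

Definition metric_bounded (B : set X) : Prop :=
  exists M : R, forall x y, B x -> B y -> mdist x y <= M.

(* A supremum in the extended reals: [+oo] if [f] is not Lipschitz, and [-oo]
   (rather than 0) if [X] is a single point. *)
Definition lip (f : X -> X) : \bar R :=
  ereal_sup [set (mdist (f p.1) (f p.2) / mdist p.1 p.2)%:E
            | p in [set p : X * X | p.1 != p.2]].

Definition bi_lipschitz (f : X -> X) : Prop :=
  exists l L : R, [/\ 0 < l, l <= L &
    forall x y, l * mdist x y <= mdist (f x) (f y) <= L * mdist x y].

End metric.

(* Infinite words, indexed from 0 instead of 1. The parameter [R] serves only
   to determine the field in which the metric takes its values; being a
   separate type from [nat -> I], it does not get the product topology. *)
Definition words (R : realType) (I : Type) : Type := nat -> I.

Section words_metric.
Context {R : realType} {I : choiceType}.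
Implicit Types u v w : words R I.

HB.instance Definition _ := Choice.copy (words R I) (nat -> I).

Let term u v (n : nat) : R := (1 - (u n == v n)%:R) / 3 ^+ n.+1.

Definition words_dist u v : R :=
  limn (series (fun n => (1 - (u n == v n)%:R) / 3 ^+ n.+1 : R)).

Let term_ge0 u v n : 0 <= term u v n.
Proof. rewrite /term divr_ge0 ?exprn_ge0//.
by case: eqVneq => _; rewrite ?subrr ?subr0. Qed.

Let term_cvg u v : cvgn (series (term u v)).
Proof.
apply: (@series_le_cvg _ _ (geometric 3^-1 3^-1)) => [n|n|n|].
- exact: term_ge0.
- by rewrite /geometric/= mulr_ge0 ?exprn_ge0 ?invr_ge0.
- rewrite /geometric/= /term -exprVn -exprS.
  by rewrite ler_piMl ?exprn_ge0 ?invr_ge0//.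
- apply: is_cvg_geometric_series.
  by rewrite ger0_norm ?invr_ge0// invf_lt1// ltr1n.
Qed.

Let distE u v : words_dist u v = limn (series (term u v)).
Proof. by []. Qed.

Let words_distxx u : words_dist u u = 0.
Proof.
rewrite distE (_ : series _ = cst 0) ?lim_cst//.
by apply/funext => n; rewrite /series/= big1// => i _; rewrite /term eqxx subrr mul0r.
Qed.

Let words_dist_sym u v : words_dist u v = words_dist v u.
Proof.
rewrite !distE; congr (limn (series _)).
by apply/funext => n; rewrite /term eq_sym.
Qed.

Let words_dist_positivity u v : words_dist u v = 0 -> u = v.
Proof.
move=> d0; apply/funext => n; apply/eqP; apply: contraPT d0 => uv.
apply/eqP; rewrite gt_eqF// distE (@lt_le_trans _ _ (series (term u v) n.+1))//.
  rewrite /series/= big_nat_recr//= ltr_wpDl ?sumr_ge0//.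
  by rewrite /term (negbTE uv) subr0 divr_gt0// exprn_gt0.
apply: nondecreasing_cvgn_le; last exact: term_cvg.
apply/nondecreasing_seqP => k.
by rewrite /series/= big_nat_recr//= lerDl.
Qed.

Let words_dist_triangle v u w :
  words_dist u w <= words_dist u v + words_dist v w.
Proof.
rewrite !distE -limD; [|exact: term_cvg..].
apply: ler_lim; [exact: term_cvg|apply: is_cvgD; exact: term_cvg|].
apply: nearW => n; rewrite /series/= [leRHS](_ : _ = 
    \sum_(0 <= i < n) term u v i + \sum_(0 <= i < n) term v w i)//.
rewrite -big_split/=; apply: ler_sum => i _.
rewrite /term -mulrDl ler_wpM2r ?invr_ge0 ?exprn_ge0//.
have [->|] := eqVneq (u i) (v i); first by rewrite subrr add0r.
move=> _; rewrite subr0; have [_|_] := eqVneq (u i) (w i).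
  by rewrite subrr addr_ge0//; case: eqVneq => _; rewrite ?subrr ?subr0.
by rewrite subr0 lerDl; case: eqVneq => _; rewrite ?subrr ?subr0.
Qed.

HB.instance Definition _ := @isMetric.Build R (words R I) words_dist
  words_distxx words_dist_positivity words_dist_sym words_dist_triangle.

End words_metric.

Section ifs.
Context {R : realType} {X : metricType R} {I : choiceType}.
Implicit Types (f : I -> X -> X) (A : set X).

Definition contraction_family f : Prop :=
  (forall B : set X, metric_bounded B ->
     metric_bounded (\bigcup_(i in setT) (f i @` B))) /\
  (ereal_sup (range (fun i => lip (f i))) < 1)%E.

Definition is_attractor f A : Prop :=
  [/\ A !=set0, closed A, metric_bounded A &
      closure (\bigcup_(i in setT) (f i @` A)) = A].

(* f_(w 0) \o ... \o f_(w (m - 1)) *)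
Definition word_comp f (w : words R I) (m : nat) : X -> X :=
  \big[(fun g h => g \o h)/id]_(k < m) f (w k).

Definition is_coding_map f A (pi : words R I -> A) : Prop :=
  forall w, \bigcap_(m in [set m | (1 <= m)%N]) (word_comp f w m @` A) =
            [set set_val (pi w)].

Definition gap f A (i j : I) : \bar R :=
  ereal_inf [set (mdist (f i p.1) (f j p.2))%:E | p in A `*` A].

End ifs.

(* Main.v *)
Require Import Defs.
From mathcomp Require Import all_boot all_order all_algebra.
From mathcomp Require Import all_classical all_reals all_analysis.
From mathcomp Require Import lra.

Import Order.TTheory GRing.Theory Num.Theory.

Local Open Scope classical_set_scope.
Local Open Scope ring_scope.

(** Only the continuity of the inverse of [pi] needs an argument, and in terms
    of words it says that points of [A] close to [pi w] have codes sharing a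
    long prefix with [w].

    Suppose that the codes [w] and [v] first differ at position [n].  Both
    points lie in the image of the common map
    [F = f_(w 0) \o ... \o f_(w (n - 1))]: they are [F (f (w n) a)] and
    [F (f (v n) b)] with [a] and [b] in [A].  By the separation hypothesis
    [f (w n) a] and [f (v n) b] are at distance at least some constant [c > 0],
    and [F], a finite composite of bi-Lipschitz maps, shrinks distances at most
    by a factor [l > 0] that depends only on [w] and [n].  So [pi w] and
    [pi v] are at distance at least [l * c].  Hence, for fixed [w], a point
    close enough to [pi w] has a code agreeing with [w] on any prescribed
    number of letters ([coding_map_agree]), and words agreeing on [n] letters
    are at distance at most [3^-n] ([words_mdist_agree]).

    When [I] is infinite, the factor [l] need not be bounded below over all [w]
    for a given [n], so the inverse is shown to be continuous at each point,
    not uniformly continuous. *)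

Lemma words_mdist_agree (R : realType) (I : choiceType) (n : nat)
    (u v : words R I) :
  (forall k, (k < n)%N -> u k = v k) -> mdist u v <= (3 ^+ n)^-1.
Proof.
move=> uv; rewrite [mdist u v]/(words_dist u v) /words_dist; set t := fun k => _.
have t0 k : 0 <= t k.
  by rewrite /t divr_ge0 ?exprn_ge0//; case: eqVneq; rewrite ?subrr ?subr0.
have ub m : series t m <= (3 ^+ n)^-1.
  have [mn|nm] := leqP m n.
    rewrite /series/= big_nat big1 ?invr_ge0 ?exprn_ge0// => k /= km.
    by rewrite /t uv ?(leq_trans km)// eqxx subrr mul0r.
  (* Adding the slack [3^-m] makes the bound provable by induction on [m];
     it is generous, the sum being at most half of [3^-n]. *)
  suff : series t m + (3 ^+ m)^-1 <= (3 ^+ n)^-1.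
    by apply: le_trans; rewrite lerDl invr_ge0 exprn_ge0.
  rewrite -(subnKC (ltnW nm)); elim: (m - n)%N => [|j IH].
    rewrite addn0 /series/= big_nat big1 ?add0r// => k /= kn.
    by rewrite /t uv// eqxx subrr mul0r.
  apply: le_trans IH; rewrite addnS /series/= big_nat_recr//= -addrA lerD2l.
  have c0 : 0 <= (3 ^+ (n + j))^-1 :> R by rewrite invr_ge0 exprn_ge0.
  have tb : t (n + j)%N <= (3 ^+ (n + j).+1)^-1.
    by rewrite /t ler_piMl ?invr_ge0 ?exprn_ge0// lerBlDr lerDl.
  move: tb; rewrite exprS invfM; move: (t _) (_^-1) c0 => a b; lra.
apply: limr_le; last exact: nearW.
apply: nondecreasing_is_cvgn.
  by apply/nondecreasing_seqP => k; rewrite /series/= big_nat_recr//= lerDl.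
by exists ((3 ^+ n)^-1) => _ [m _ <-].
Qed.

Section iterated_function_system.
Context (R : realType) (X : metricType R) (I : choiceType).
Implicit Types (f : I -> X -> X) (A : set X) (w : words R I).

(** The big operator peels off the first, outermost map; comparing two codes
    at the position where they part requires peeling off the innermost one. *)
Lemma word_comp_recr f w m :
  word_comp f w m.+1 = word_comp f w m \o f (w m).
Proof.
rewrite /word_comp; elim: m w => [|m IH] w; first by rewrite big_ord_recl !big_ord0.
by rewrite big_ord_recl /= (IH (fun k => w k.+1)) [in RHS]big_ord_recl.
Qed.

Lemma word_comp_eq f w v m :
  (forall k, (k < m)%N -> v k = w k) -> word_comp f v m = word_comp f w m.
Proof. by move=> vw; apply: eq_bigr => k _; rewrite vw. Qed.

(** The factor is the product of the lower bi-Lipschitz constants of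
    [f (w 0)], ..., [f (w (m - 1))], a finite product of positive numbers. *)
Lemma word_comp_lower_lipschitz f w m : (forall i, bi_lipschitz (f i)) ->
  exists2 l : R, 0 < l &
    forall x y, l * mdist x y <= mdist (word_comp f w m x) (word_comp f w m y).
Proof.
move=> fbl; elim: m => [|m [l l0 IH]].
  by exists 1 => // x y; rewrite /word_comp big_ord0 mul1r.
have [l' [L [l'0 _ fl']]] := fbl (w m).
exists (l * l') => [|x y]; first exact: mulr_gt0.
rewrite word_comp_recr /= -mulrA; apply: le_trans (IH _ _).
by rewrite ler_pM2l//; have /andP[] := fl' x y.
Qed.

(** A real witness is extracted from the extended infimum; when that infimum is
    [+oo] there are no two distinct letters, or [A] is empty, and any positive
    constant will do. *)
Lemma gap_separated f A :
  (0 < ereal_inf [set gap f A p.1 p.2 | p in [set p : I * I | p.1 != p.2]])%E ->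
  exists2 c : R, 0 < c & forall i j x y, i != j -> A x -> A y ->
    c <= mdist (f i x) (f j y).
Proof.
set g := ereal_inf _ => g0.
have le_g i j x y : i != j -> A x -> A y -> (g <= (mdist (f i x) (f j y))%:E)%E.
  move=> ij Ax Ay; apply: (@le_trans _ _ (gap f A i j)).
    by apply: ereal_inf_lbound; exists (i, j).
  by apply: ereal_inf_lbound; exists (x, y).
move: g0 le_g; case: g => [c| |] c0 le_g; last by [].
  exists c => [|i j x y *]; first by rewrite -lte_fin.
  by rewrite -lee_fin le_g.
by exists 1 => // i j x y ij Ax Ay; have := le_g i j x y ij Ax Ay.
Qed.

(** The induction on [n] deals with the first [n] letters, so that only a first
    disagreement exactly at position [n] has to be excluded. It would push the
    two points, which then lie in the same cylinder of level [n] but in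
    different pieces of it, at a distance bounded below independently of [v]. *)
Lemma coding_map_agree f A (pi : words R I -> A) w n :
  (forall i, bi_lipschitz (f i)) -> is_coding_map f pi ->
  (0 < ereal_inf [set gap f A p.1 p.2 | p in [set p : I * I | p.1 != p.2]])%E ->
  exists2 e : R, 0 < e & forall v, mdist (set_val (pi w)) (set_val (pi v)) < e ->
    forall k, (k < n)%N -> w k = v k.
Proof.
move=> fbl fpi /gap_separated[c c0 fc].
elim: n => [|n [e e0 IH]]; first by exists 1.
have [l l0 fl] := word_comp_lower_lipschitz f w n fbl.
exists (Num.min e (l * c)); first by rewrite lt_min e0 mulr_gt0.
move=> v; rewrite lt_min => /andP[/IH agree].
rewrite ltNge => /negP near_v k; rewrite ltnS leq_eqVlt => /orP[/eqP->|/agree//].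
apply/eqP/negPn/negP => wv; apply: near_v.
have in_cyl u : exists2 a, A a & word_comp f u n (f (u n) a) = set_val (pi u).
  have : [set set_val (pi u)] (set_val (pi u)) by [].
  by rewrite -fpi => /(_ n.+1 isT) [a Aa]; rewrite word_comp_recr; exists a.
have [a Aa <-] := in_cyl w; have [b Ab <-] := in_cyl v.
rewrite (word_comp_eq f w v n) => [|j /agree->//].
by apply: le_trans (fl _ _); rewrite ler_pM2l// fc.
Qed.

End iterated_function_system.

(* [ereal_inf] of the empty set is [+oo]: the separation hypothesis holds
   trivially when [I] has a single element. *)
Theorem theorem6p1 (R : realType) (X : completeMetricType R) (I : pointedType)
    (f : I -> X -> X) (A : set X) (pi : words R I -> A)
    (hf : contraction_family f) (hbl : forall i, bi_lipschitz (f i))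
    (hA : is_attractor f A) (hpi : is_coding_map f pi)
    (pi_cont : continuous pi) (pi_bij : bijective pi)
    (hgap : (0 < ereal_inf [set gap f A p.1 p.2
                           | p in [set p : I * I | p.1 != p.2]])%E) :
  homeomorphism pi.
Proof.
split=> //; have [g pigK gpiK] := pi_bij; exists g; split=> // a.
move=> U /metricType_numDomainType.nbhs_mdistP[e /= e0 eU].
have [n lt_e] : exists n, (3 ^+ n)^-1 < e :> R.
  have /cvgrPdist_lt : (3^-1 : R) ^+ n @[n --> \oo] --> 0.
    by apply: cvg_expr; rewrite ger0_norm ?invr_ge0// invf_lt1// ltr1n.
  move=> /(_ e e0) [n _ /(_ n (leqnn n))] /=.
  by rewrite sub0r normrN exprVn ger0_norm ?invr_ge0 ?exprn_ge0//; exists n.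
have [d d0 agree] := coding_map_agree R X I f A pi (g a) n hbl hpi hgap.
(* The topology of [A] is induced by the inclusion in [X], so a neighborhood
   of [a] in [A] is obtained by pulling back a ball of [X]. *)
have : nbhs (set_val a) [set y | mdist (set_val a) y < d].
  by apply/metricType_numDomainType.nbhs_mdistP; exists d.
move=> /(@initial_continuous A X set_val a).
apply: (@filterS _ _ (nbhs_filter a)) => x ax; apply: eU.
rewrite /= (le_lt_trans _ lt_e)//.
by apply: words_mdist_agree; apply: agree; rewrite !gpiK.
Qed.
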